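(* Let $G=([n],E)$ be a digraph without loops and parallel arcs, and let $\alpha\in[0,1)$ be such that for every $\beta\in(\alpha,1)$ and every $B\in\mathcal B$ the matrix $M_B(\beta)$ is invertible (such an $\alpha$ exists). Then there exists $\alpha^*\in(0,1)$ with $\alpha^*\geq\alpha$ such that for all $\beta\in[\alpha^*,1)$, $\Gamma(G,\beta)=\Gamma(G,\alpha^* )$.
   Context: $G=(V,E)$ is a digraph without loops and parallel arcs on node set $V=[n]=\{1,\dots,n\}$, $n\geq 2$; $N^-(i)=\{j:(j,i)\in E\}$, $N^+(i)=\{j:(i,j)\in E\}$. For $\beta\in(0,1)$, the polytope $\mathcal{WH}_\beta(G)$ is the set of all $(x,y)\in\mathbb R^{E}\times\mathbb R^{V\setminus\{1\}}$ satisfying the $2n$ equations (1) $\sum_{j\in N^+(1)}x_{1j}-\beta\sum_{j\in N^-(1)}x_{j1}=1-\beta^n$; (2) $\sum_{j\in N^+(i)}x_{ij}-\beta\sum_{j\in N^-(i)}x_{ji}=0$ for $i\in V\setminus\{1\}$; (3) $\sum_{j\in N^+(1)}x_{1j}=1$; (4) $\sum_{j\in N^+(i)}x_{ij}-y_i=\beta^{n-1}$ for $i\in V\setminus\{1\}$; and the bounds (5) $0\leq y_i\leq\beta-\beta^{n-1}$ for $i\in V\setminus\{1\}$; (6) $x_{ij}\geq0$ for $(i,j)\in E$. Consider triples $(B,L,U)$ where $B=A\cup Y$ with $A\subseteq E$ (basic variables $x_{ij}$), $Y\subseteq V\setminus\{1\}$ (basic variables $y_i$), $|B|=|A|+|Y|=2n$,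 and $L\cup U$ is a partition (parts possibly empty) of $V\setminus(\{1\}\cup Y)$. $M_B(\beta)$ is the $2n\times 2n$ submatrix of the coefficient matrix of (1)–(4) formed by the columns of the variables in $B$. $\mathcal B$ is the set of all such $B=A\cup Y$ with $|B|=2n$ for which the polynomial $\det M_B(\beta)$ in $\beta$ is not identically zero. Set non-basic variables to $x_{ij}=0$ for $(i,j)\in E\setminus A$, $y_i=0$ for $i\in L$, $y_i=\beta-\beta^{n-1}$ for $i\in U$. The triple $(B,L,U)$ is a feasible basis for $\mathcal{WH}_\beta(G)$ if $M_B(\beta)$ is invertible and the resulting unique solution of (1)–(4) satisfies (5) and (6). $\Gamma(G,\beta)$ is the set of all feasible bases $(B,L,U)$ for $\mathcal{WH}_\beta(G)$. *)

(* Defs.v *)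
From mathcomp Require Import all_boot all_order all_algebra.
From mathcomp Require Import all_classical all_reals.

Set Implicit Arguments.
Unset Strict Implicit.
Unset Printing Implicit Defensive.

Import Order.TTheory GRing.Theory Num.Theory.
Local Open Scope ring_scope.

(* The node set {1, ..., n} with n >= 2 is 'I_m.+2, that is n = m.+2; the node
   called 1 is ord0.  A digraph without parallel arcs is its set of arcs E, the pair
   (i, j) being the arc from i to j. *)
Section WeightedHamiltonian.
Variable m : nat.
Local Notation n := (m.+2).
Variable E : {set 'I_n * 'I_n}.

Definition loopless := forall i : 'I_n, (i, i) \notin E.

Definition darc := {e : 'I_n * 'I_n | e \in E}.
Definition node' := {i : 'I_n | i != ord0}.
Definition src (e : darc) : 'I_n := (val e).1.
Definition dst (e : darc) : 'I_n := (val e).2.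

(* inl e stands for the variable x_e and inr i for the variable y_i. *)
Definition var := (darc + node')%type.

Section System.
Variable K : comNzRingType.
Implicit Types (b : K) (x : {ffun darc -> K}) (y : {ffun node' -> K}).

Definition outflow x (i : 'I_n) : K := \sum_(e : darc | src e == i) x e.
Definition inflow x (i : 'I_n) : K := \sum_(e : darc | dst e == i) x e.

Definition wh_equations b x y : Prop :=
  [/\ outflow x ord0 - b * inflow x ord0 = 1 - b ^+ n,
      forall i : node', outflow x (val i) - b * inflow x (val i) = 0,
      outflow x ord0 = 1 &
      forall i : node', outflow x (val i) - y i = b ^+ n.-1].

(* For each node i, row lshift n i is the flow equation at i (with b as
   discount factor) and row rshift n i is the outflow equation at i. *)
Definition coef b (r : 'I_(n + n)) (v : var) : K :=
  match fintype.split r, v with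
  | inl i, inl e => (src e == i)%:R - b * (dst e == i)%:R
  | inl _, inr _ => 0
  | inr i, inl e => (src e == i)%:R
  | inr i, inr k => - (val k == i)%:R
  end.

Definition rhs b (r : 'I_(n + n)) : K :=
  match fintype.split r with
  | inl i => if i == ord0 then 1 - b ^+ n else 0
  | inr i => if i == ord0 then 1 else b ^+ n.-1
  end.

Lemma wh_equationsE b x y :
  wh_equations b x y <->
  forall r, \sum_(e : darc) coef b r (inl e) * x e
            + \sum_(i : node') coef b r (inr i) * y i = rhs b r.
Proof.
have out i : \sum_(e : darc) (src e == i)%:R * x e = outflow x i.
  rewrite /outflow [RHS]big_mkcond; apply: eq_bigr => e _.
  by case: eqP => _; rewrite ?mul1r ?mul0r.
have inn i : \sum_(e : darc) (dst e == i)%:R * x e = inflow x i.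
  rewrite /inflow [RHS]big_mkcond; apply: eq_bigr => e _.
  by case: eqP => _; rewrite ?mul1r ?mul0r.
have rowl i : \sum_(e : darc) coef b (lshift n i) (inl e) * x e
    + \sum_(k : node') coef b (lshift n i) (inr k) * y k
    = outflow x i - b * inflow x i.
  rewrite /coef -[lshift n i]/(unsplit (inl i)) unsplitK.
  rewrite [X in _ + X]big1 ?addr0 => [|k _]; last by rewrite mul0r.
  rewrite -out -inn mulr_sumr -sumrB; apply: eq_bigr => e _.
  by rewrite mulrBl mulrA.
have rowr i : \sum_(e : darc) coef b (rshift n i) (inl e) * x e
    + \sum_(k : node') coef b (rshift n i) (inr k) * y k
    = outflow x i - \sum_(k : node' | val k == i) y k.
  rewrite /coef -[rshift n i]/(unsplit (inr i)) unsplitK out.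
  congr (_ + _); rewrite [X in _ = - X]big_mkcond -sumrN.
  apply: eq_bigr => k _.
  by case: eqP => _; rewrite ?mulN1r ?oppr0 ?mul0r.
have y0 : \sum_(k : node' | val k == ord0) y k = 0.
  by apply: big_pred0 => k; apply/negbTE/(valP k).
have yk (i : node') : \sum_(k : node' | val k == val i) y k = y i.
  by rewrite (eq_bigl (pred1 i)) ?big_pred1_eq.
have rhsl i : rhs b (lshift n i) = if i == ord0 then 1 - b ^+ n else 0.
  by rewrite /rhs -[lshift n i]/(unsplit (inl i)) unsplitK.
have rhsr i : rhs b (rshift n i) = if i == ord0 then 1 else b ^+ n.-1.
  by rewrite /rhs -[rshift n i]/(unsplit (inr i)) unsplitK.
split=> [[h1 h2 h3 h4] r | h].
  rewrite -(splitK r); case: (fintype.split r) => i /=.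
    rewrite rowl rhsl; case: (eqVneq i ord0) => [-> // | i0].
    exact: (h2 (Sub i i0)).
  rewrite rowr rhsr; case: (eqVneq i ord0) => [-> | i0].
    by rewrite y0 subr0.
  by have := h4 (Sub i i0); rewrite -yk SubK.
split=> [|i||i].
- by have := h (lshift n ord0); rewrite rowl rhsl eqxx.
- by have := h (lshift n (val i)); rewrite rowl rhsl (negbTE (valP i)).
- by have := h (rshift n ord0); rewrite rowr rhsr eqxx y0 subr0.
- by have := h (rshift n (val i)); rewrite rowr rhsr (negbTE (valP i)) yk.
Qed.

End System.

(* Any 2n variables, whether or not their columns are independent. *)
Definition basis := {B : {set var} | #|B| == (n + n)%N}.

Definition basis_var (B : basis) (k : 'I_(n + n)) : var :=
  enum_val (cast_ord (esym (eqP (valP B))) k).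

(* The columns are taken in the order of the enumeration of B. *)
Definition basis_mx (K : comNzRingType) (b : K) (B : basis) : 'M[K]_(n + n) :=
  \matrix_(r, k) coef b r (basis_var B k).

Definition basicY (B : basis) : {set node'} := [set i | inr i \in val B].

Section Real.
Variable R : realType.

(* det M_B(b) as a polynomial in b: the matrix is taken over {poly R}, at 'X. *)
Definition generic_bases : {set basis} :=
  [set B : basis | \det (basis_mx ('X : {poly R}) B) != 0].

Definition whpoint := ({ffun darc -> R} * {ffun node' -> R})%type.

Definition wh_bounds (b : R) (z : whpoint) : Prop :=
  (forall i : node', 0 <= z.2 i <= b - b ^+ n.-1) /\
  (forall e : darc, 0 <= z.1 e).

Definition WH (b : R) : set whpoint :=
  [set z | wh_equations b z.1 z.2 /\ wh_bounds b z]%classic.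

Definition triple := (basis * {set node'} * {set node'})%type.

Definition basic_solution (b : R) (t : triple) (z : whpoint) : Prop :=
  let: (B, L, U) := t in
  [/\ wh_equations b z.1 z.2,
      forall e : darc, inl e \notin val B -> z.1 e = 0,
      forall i : node', i \in L -> z.2 i = 0 &
      forall i : node', i \in U -> z.2 i = b - b ^+ n.-1].

Definition feasible_basis (b : R) (t : triple) : Prop :=
  let: (B, L, U) := t in
  [/\ L :|: U = ~: basicY B,
      [disjoint L & U],
      basis_mx b B \in unitmx &
      exists2 z, unique (basic_solution b t) z & WH b z].

Definition Gamma (b : R) : set triple := [set t | feasible_basis b t]%classic.

Definition invertible_above (alpha : R) : Prop :=
  forall b : R, alpha < b < 1 ->
  forall B : basis, B \in generic_bases -> basis_mx b B \in unitmx.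

End Real.
End WeightedHamiltonian.

Arguments generic_bases {m} E R.
Arguments WH {m} E {R} b _.
Arguments Gamma {m} E {R} b _.
Arguments invertible_above {m} E {R} alpha.

(* Main.v *)
Require Import Defs.
From mathcomp Require Import all_boot all_order all_algebra.
From mathcomp Require Import all_classical all_reals.
From mathcomp Require Import topology normedtype polyrcf.

Set Implicit Arguments.
Unset Strict Implicit.
Unset Printing Implicit Defensive.

Import Order.TTheory GRing.Theory Num.Theory.
Local Open Scope ring_scope.

(** Why the feasible bases stabilise as b tends to 1 from below.

    There are finitely many triples (B, L, U), so it is enough that the
    feasibility of each single one is eventually constant near 1.  Once the
    nonbasic variables are fixed, the basic ones solve a square linear system
    with matrix M_B(b), whose entries and right-hand side are polynomials in b.
    Cramer's rule then gives every variable as a quotient of two polynomials in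
    b with denominator det M_B(b) ([basic_solutionP]).  Multiplying the bounds
    by the square of the denominator turns feasibility into a finite
    conjunction of statements of the form p(b) <> 0 or p(b) >= 0, where p is a
    polynomial that does not depend on b ([feasible_basisP]).  A nonzero
    polynomial has finitely many roots, so its sign is constant on some
    interval to the left of 1 ([horner_sgr_near_left]); hence so is the truth
    value of each condition, and that of their conjunction
    ([settled_feasible_basis]).

    Finitely many left neighbourhoods of 1 intersect in another one, and
    alpha' can be taken in it as close to 1 as desired, in particular above
    any given alpha.  The existence of alpha follows in the same way from the
    nonzero polynomials det M_B of the finitely many generic bases. *)

(** * Truth values near a point, from the left *)

Section NearLeft.
Local Open Scope classical_set_scope.
Variable R : realType.
Implicit Types (p : {poly R}) (P : R -> Prop) (a b c x : R).

(** The interval is closed at [a], so that [a] itself can serve as the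
    reference value that all later parameters are compared with. *)
Lemma near_left_itv P x c : c < x -> (\forall b \near x^'-, P b) ->
  exists2 a, c < a < x & forall b, a <= b < x -> P b.
Proof.
move=> cx Px; have : \forall b \near x^'-, b < x -> P b /\ c < b.
  by near=> b => _; split; near: b => //; exact: nbhs_left_gt.
case=> e /= e0 He; pose a := Num.max ((c + x) / 2) (x - e / 2).
have ax : a < x by rewrite gt_max midf_lt //= ltrBlDr ltrDl divr_gt0.
have near_a b : a <= b < x -> P b /\ c < b.
  move=> /andP[ab bx]; apply: He => //.
  rewrite /ball /= gtr0_norm ?subr_gt0 // ltrBlDr -ltrBlDl.
  rewrite (lt_le_trans _ ab) // lt_max orbC ltrD2l ltrN2.
  by rewrite ltr_pdivrMr // ltr_pMr // ltr1n.
exists a => [|b /near_a[]//].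
by rewrite ax andbT; case: (near_a a); rewrite ?lexx.
Unshelve. all: by end_near. Qed.

(** A nonzero polynomial has no root between its last root before [x] and [x],
    hence no change of sign there, by the intermediate value theorem. *)
Lemma horner_sgr_near_left p x :
  exists s : R, (s == 0) = (p == 0) /\ \forall b \near x^'-, Num.sg p.[b] = s.
Proof.
have [-> | p0] := eqVneq p 0.
  by exists 0; rewrite eqxx; split=> //; near=> b; rewrite horner0 sgr0.
have x1 : x - 1 < x by rewrite ltrBlDr ltrDl.
have [w pw] := neighpl_wit x1 p0; exists (Num.sg p.[w]).
rewrite sgr_eq0 -rootE (negbTE (neighpl_root pw)); split=> //.
near=> b; apply: (sgr_neighpl_same _ pw); rewrite in_itv /=.
apply/andP; split; near: b; last exact: nbhs_left_lt.
by apply: nbhs_left_gt; exact: prev_root_lt.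
Unshelve. all: by end_near. Qed.

(** Unlike convergence of the truth value to [True], this notion also covers
    conditions that are eventually false, so that it is stable under
    conjunction without any knowledge of which of the two cases occurs. *)
Definition settled x P := exists Q : Prop, \forall b \near x^'-, P b <-> Q.

Lemma settled_const x (Q : Prop) : settled x (fun=> Q).
Proof. by exists Q; near=> b. Unshelve. all: by end_near. Qed.

Lemma settled_and x P1 P2 :
  settled x P1 -> settled x P2 -> settled x (fun b => P1 b /\ P2 b).
Proof.
move=> [Q1 H1] [Q2 H2]; exists (Q1 /\ Q2).
near=> b; have -> : P1 b <-> Q1 by near: b.
by have -> : P2 b <-> Q2 by near: b.
Unshelve. all: by end_near. Qed.

Lemma settled_uniform x (I : finType) (P : I -> R -> Prop) :
  (forall i, settled x (P i)) ->
  exists Q : I -> Prop, \forall b \near x^'-, forall i, P i b <-> Q i.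
Proof. by move=> /choice[Q HQ]; exists Q; exact: filter_forall. Qed.

Lemma settled_forall x (I : finType) (P : I -> R -> Prop) :
  (forall i, settled x (P i)) -> settled x (fun b => forall i, P i b).
Proof.
move=> /settled_uniform[Q HQ]; exists (forall i, Q i).
by near=> b; split=> PQ i; apply/(near HQ b) => //; apply: PQ.
Unshelve. all: by end_near. Qed.

Lemma settled_horner_ge0 x p : settled x (fun b => 0 <= p.[b]).
Proof.
have [s [_ ps]] := horner_sgr_near_left p x; exists (0 <= s).
by near=> b; rewrite -sgr_ge0 (near ps b).
Unshelve. all: by end_near. Qed.

Lemma settled_horner_neq0 x p : settled x (fun b => p.[b] != 0).
Proof.
have [s [_ ps]] := horner_sgr_near_left p x; exists (s != 0).
by near=> b; rewrite -sgr_eq0 (near ps b).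
Unshelve. all: by end_near. Qed.

End NearLeft.

(** * The basic solution by Cramer's rule *)

Section Cramer.
Variables (m : nat) (E : {set 'I_m.+2 * 'I_m.+2}).
Local Notation n := (m.+2).
Local Notation var := (var E).
Local Notation node' := (node' m).
Local Notation basis := (Defs.basis E).
Implicit Types (B : basis) (L U : {set node'}) (k : 'I_(n + n)) (v : var).

(* Everything is defined over an arbitrary ring, to be used both at a real b
   and at the indeterminate of {poly R}: evaluation is a ring morphism and
   carries the latter to the former. *)
Section Ring.
Variable K : comNzRingType.
Implicit Type b : K.

Definition ybound b : K := b - b ^+ n.-1.

Definition nonbasic_value b U v : K :=
  if v is inr i then ybound b *+ (i \in U) else 0.

Definition reduced_rhs b U : 'cV[K]_(n + n) :=
  \col_r (rhs b r - \sum_v coef b r v * nonbasic_value b U v).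

Definition cramer b B U : 'cV[K]_(n + n) :=
  \adj (basis_mx b B) *m reduced_rhs b U.

(** The value of the variable [v] in the basic solution, multiplied by the
    determinant so as to stay polynomial in [b].  The sum has one term when [v]
    is basic and none otherwise, and [nonbasic_value] vanishes on the basic
    variables when [U] consists of nonbasic ones. *)
Definition scaled_solution b B U v : K :=
  \sum_(k | basis_var B k == v) cramer b B U k 0
    + \det (basis_mx b B) * nonbasic_value b U v.

End Ring.

Section Morphism.
Variables (K K' : comNzRingType) (f : {rmorphism K -> K'}) (b : K).

Lemma rmorph_coef r v : f (coef b r v) = coef (f b) r v.
Proof.
rewrite /coef; case: (fintype.split r) => i; case: v => j;
  by rewrite ?(rmorphB, rmorphM, rmorphN, rmorph_nat, rmorph0).
Qed.

Lemma rmorph_rhs (r : 'I_(n + n)) : f (rhs b r) = rhs (f b) r.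
Proof.
rewrite /rhs; case: (fintype.split r) => i; case: ifP => _;
  by rewrite ?(rmorphB, rmorphXn, rmorph1, rmorph0).
Qed.

Lemma rmorph_ybound : f (ybound b) = ybound (f b).
Proof. by rewrite /ybound rmorphB rmorphXn. Qed.

Lemma rmorph_nonbasic_value U v :
  f (nonbasic_value b U v) = nonbasic_value (f b) U v.
Proof.
by case: v => i /=; rewrite ?rmorph0 // rmorphMn /= rmorph_ybound.
Qed.

Lemma map_basis_mx B : map_mx f (basis_mx b B) = basis_mx (f b) B.
Proof. by apply/matrixP => r k; rewrite !mxE rmorph_coef. Qed.

Lemma rmorph_det_basis_mx B :
  f (\det (basis_mx b B)) = \det (basis_mx (f b) B).
Proof. by rewrite -det_map_mx map_basis_mx. Qed.

Lemma map_cramer B U : map_mx f (cramer b B U) = cramer (f b) B U.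
Proof.
rewrite /cramer map_mxM map_mx_adj map_basis_mx; congr (_ *m _).
apply/matrixP => r k; rewrite !mxE rmorphB rmorph_rhs rmorph_sum.
congr (_ - _); apply: eq_bigr => v _.
by rewrite rmorphM /= rmorph_coef rmorph_nonbasic_value.
Qed.

Lemma rmorph_scaled_solution B U v :
  f (scaled_solution b B U v) = scaled_solution (f b) B U v.
Proof.
rewrite /scaled_solution rmorphD rmorphM /= rmorph_det_basis_mx.
rewrite rmorph_nonbasic_value rmorph_sum -map_cramer; congr (_ + _).
by apply: eq_bigr => k _; rewrite [RHS]mxE.
Qed.

End Morphism.

Lemma basis_var_inj B : injective (basis_var B).
Proof. by move=> k l /enum_val_inj/cast_ord_inj. Qed.

Lemma basis_var_in B k : basis_var B k \in val B.
Proof. exact: enum_valP. Qed.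

Lemma basis_varP B v : v \in val B -> exists k, v = basis_var B k.
Proof.
move=> vB; exists (cast_ord (eqP (valP B)) (enum_rank_in vB v)).
by rewrite /basis_var cast_ordK enum_rankK_in.
Qed.

Section Real.
Variable R : realType.
Implicit Types (b : R) (z : whpoint E R).

Definition coord z v : R :=
  match v with inl e => z.1 e | inr i => z.2 i end.

Lemma wh_equations_coord b z :
  wh_equations b z.1 z.2 <->
  forall r, \sum_v coef b r v * coord z v = rhs b r.
Proof.
rewrite wh_equationsE.
by split=> H r; move: (H r); rewrite big_sumType.
Qed.

Lemma nonbasic_value_basic b B L U k :
  L :|: U = ~: basicY B -> nonbasic_value b U (basis_var B k) = 0.
Proof.
move=> /setP LU; case def_v: (basis_var B k) => [//|i] /=.
have := LU i; rewrite !inE -def_v basis_var_in /= => /negbT.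
by rewrite negb_or => /andP[_ /negbTE->].
Qed.

Lemma scaled_solution_basic b B L U k : L :|: U = ~: basicY B ->
  scaled_solution b B U (basis_var B k) = cramer b B U k 0.
Proof.
move=> LU; rewrite /scaled_solution (nonbasic_value_basic _ _ LU) mulr0 addr0.
by rewrite (big_pred1 k) // => l; rewrite (inj_eq (@basis_var_inj B)).
Qed.

Lemma scaled_solution_nonbasic b B U v : v \notin val B ->
  scaled_solution b B U v = \det (basis_mx b B) * nonbasic_value b U v.
Proof.
move=> vB; rewrite /scaled_solution big_pred0 ?add0r // => k.
by apply: contraNF vB => /eqP <-; exact: basis_var_in.
Qed.

(** Moving the known nonbasic terms to the right-hand side leaves a square
    system in the basic variables. *)
Lemma wh_equations_basis_mx b z B L U : L :|: U = ~: basicY B ->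
  (forall v, v \notin val B -> coord z v = nonbasic_value b U v) ->
  wh_equations b z.1 z.2 <->
  basis_mx b B *m (\col_k coord z (basis_var B k)) = reduced_rhs b U.
Proof.
move=> LU zN; rewrite wh_equations_coord.
have sumE r : \sum_v coef b r v * coord z v =
    (basis_mx b B *m (\col_k coord z (basis_var B k))) r 0
    + \sum_v coef b r v * nonbasic_value b U v.
  rewrite mxE (bigID (mem (val B))) [in X in _ = _ + X](bigID (mem (val B))) /=.
  rewrite [X in _ = _ + (X + _)]big1 ?add0r; last first.
    by move=> _ /basis_varP[k ->]; rewrite (nonbasic_value_basic _ _ LU) mulr0.
  congr (_ + _); last by apply: eq_bigr => v /zN->.
  (* The inverse of [basis_var B], with an arbitrary value off B. *)
  rewrite (reindex_onto (basis_var B) (fun v =>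
    odflt (lshift n ord0) [pick k | basis_var B k == v])) /=; last first.
    by move=> _ /basis_varP[k ->]; case: pickP => [l /eqP//|/(_ k)/eqP].
  apply: eq_big => [k | k _]; last by rewrite !mxE.
  rewrite basis_var_in /=.
  by case: pickP => [l /eqP/basis_var_inj->|/(_ k)]; rewrite eqxx.
split=> [H | H r].
  by apply/colP => r; rewrite [RHS]mxE -H sumE addrK.
by rewrite sumE H mxE subrK.
Qed.

(** Multiplying the square system by the adjugate matrix gives the values of
    the basic variables up to the factor det; multiplying back by M_B shows that
    these values do solve it. As det is nonzero, this description contains both
    the existence and the uniqueness of the basic solution. *)
Lemma basic_solutionP b B L U z :
    L :|: U = ~: basicY B -> [disjoint L & U] -> \det (basis_mx b B) != 0 ->
  basic_solution b (B, L, U) z <->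
  forall v, \det (basis_mx b B) * coord z v = scaled_solution b B U v.
Proof.
move=> LU dLU d0; set d := \det _ in d0 *.
have inLU (i : node') : inr i \notin val B -> (i \in L) || (i \in U).
  by move=> iB; rewrite -finset.in_setU LU !inE.
have nonbasicP : [/\ forall e, inl e \notin val B -> z.1 e = 0,
      forall i, i \in L -> z.2 i = 0 & forall i, i \in U -> z.2 i = ybound b]
    <-> forall v, v \notin val B -> coord z v = nonbasic_value b U v.
  split=> [[z1 zL zU] [e|i] vB /=|zN]; first exact: z1.
    case: (boolP (i \in U)) (inLU i vB) => [/zU-> // | _].
    by rewrite orbF => /zL.
  have iN i : i \in L :|: U -> inr i \notin val B by rewrite LU !inE.
  split=> [e /zN//|i iL|i iU].
    by rewrite -[LHS]/(coord z (inr i)) zN ?iN ?inE ?iL //= (disjointFr dLU iL).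
  by rewrite -[LHS]/(coord z (inr i)) zN ?iN ?inE ?iU ?orbT //= iU.
transitivity (wh_equations b z.1 z.2 /\
    forall v, v \notin val B -> coord z v = nonbasic_value b U v).
  by rewrite -nonbasicP; split=> [[? ? ? ?]|[? []]].
split=> [[zE zN] v | zS].
  have [/basis_varP[k ->]|vB] := boolP (v \in val B); last first.
    by rewrite scaled_solution_nonbasic // zN.
  rewrite (scaled_solution_basic _ _ LU) /cramer.
  move/(wh_equations_basis_mx LU zN): zE => <-.
  by rewrite mulmxA mul_adj_mx mul_scalar_mx !mxE.
have zN v : v \notin val B -> coord z v = nonbasic_value b U v.
  by move=> vB; apply: (mulfI d0); rewrite zS scaled_solution_nonbasic.
split=> //; apply/(wh_equations_basis_mx LU zN).
apply: (can_inj (scalerK d0)); rewrite scalemxAr.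
have -> : d *: (\col_k coord z (basis_var B k)) = cramer b B U.
  apply/colP => k.
  by rewrite -(scaled_solution_basic _ _ LU) -zS !mxE.
by rewrite mulmxA mul_mx_adj mul_scalar_mx.
Qed.

(** Since z = s / d, the bounds z >= 0 and z <= u say that d * s >= 0 and
    d * (d * u - s) >= 0: multiplication by the positive number d ^ 2 removes the
    denominators without a case distinction on the sign of d. *)
Lemma feasible_basisP b B L U :
  let d := \det (basis_mx b B) in let s := scaled_solution b B U in
  feasible_basis b (B, L, U) <->
  (L :|: U = ~: basicY B /\ [disjoint L & U]) /\ d != 0 /\
  (forall v, 0 <= d * s v) /\ forall i, 0 <= d * (d * ybound b - s (inr i)).
Proof.
move=> d s; rewrite /feasible_basis unitmxE unitfE -/d.
have boundsP z : d != 0 -> (forall v, d * coord z v = s v) ->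
    wh_bounds b z <->
    (forall v, 0 <= d * s v) /\ forall i, 0 <= d * (d * ybound b - s (inr i)).
  move=> d0 zs; have dd x : (0 <= d * (d * x)) = (0 <= x).
    by rewrite mulrA pmulr_rge0 // -expr2 exprn_even_gt0.
  split=> [[z2 z1]|[sg0 sgu]].
    split=> [[e|i]|i]; rewrite -zs -?mulrBr dd //=; first by case/andP: (z2 i).
    by rewrite subr_ge0; case/andP: (z2 i).
  have zge0 v : 0 <= coord z v by rewrite -dd zs.
  split=> [i|e]; last exact: (zge0 (inl e)).
  apply/andP; split; first exact: (zge0 (inr i)).
  by rewrite -subr_ge0 -dd mulrBr (zs (inr i)).
split=> [[LU dLU d0 [z [/(basic_solutionP z LU dLU d0) zs _] [_ zb]]]|].
  by do 2!split=> //; apply/(boundsP z).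
move=> [[LU dLU] [d0 signs]].
pose z : whpoint E R :=
  ([ffun e => d^-1 * s (inl e)], [ffun i => d^-1 * s (inr i)]).
have zs v : d * coord z v = s v.
  by case: v => i /=; rewrite ffunE mulVKf.
have zsol : basic_solution b (B, L, U) z by apply/(basic_solutionP z LU dLU d0).
split=> //; exists z; last by split; [case: zsol|apply/(boundsP z)].
split=> // z' /(basic_solutionP z' LU dLU d0) zs'.
have zz' v : coord z v = coord z' v by apply: (mulfI d0); rewrite zs zs'.
apply: injective_projections; apply/ffunP => i;
  [exact: (zz' (inl i)) | exact: (zz' (inr i))].
Qed.

(** * Stability of the feasible bases near 1 *)

Lemma settled_feasible_basis (t : triple E) :
  settled 1 (fun b : R => feasible_basis b t).
Proof.
case: t => [[B L] U].
pose d : {poly R} := \det (basis_mx 'X B).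
pose s : var -> {poly R} := scaled_solution 'X B U.
have dE b : \det (basis_mx b B) = d.[b].
  by rewrite -horner_evalE rmorph_det_basis_mx /= horner_evalE hornerX.
have sE b v : scaled_solution b B U v = (s v).[b].
  by rewrite -horner_evalE rmorph_scaled_solution /= horner_evalE hornerX.
have yE b : ybound b = (ybound 'X).[b].
  by rewrite -horner_evalE rmorph_ybound /= horner_evalE hornerX.
have [Q HQ] : settled 1 (fun b : R =>
   (L :|: U = ~: basicY B /\ [disjoint L & U]) /\ d.[b] != 0 /\
   (forall v, 0 <= (d * s v).[b]) /\
   forall i, 0 <= (d * (d * ybound 'X - s (inr i))).[b]).
  apply: settled_and; first exact: settled_const.
  apply: settled_and; first exact: settled_horner_neq0.
  by apply: settled_and; apply: settled_forall => ?; exact: settled_horner_ge0.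
exists Q; near=> b; rewrite -(near HQ b) // feasible_basisP dE.
split=> [[? [? [H1 H2]]]|[? [? [H1 H2]]]]; do 3!split=> //.
- by move=> v; rewrite hornerM -sE.
- by move=> i; rewrite hornerM hornerD hornerN hornerM -sE -yE.
- by move=> v; rewrite sE -hornerM.
- by move=> i; have := H2 i; rewrite hornerM hornerD hornerN hornerM -sE -yE.
Unshelve. all: by end_near. Qed.

Lemma generic_bases_near_unitmx :
  \forall b \near ((1 : R)^'-)%classic,
    forall B, B \in generic_bases E R -> basis_mx b B \in unitmx.
Proof.
apply: filter_forall => B.
have [s [s0 Hs]] := horner_sgr_near_left (\det (basis_mx ('X : {poly R}) B)) 1.
near=> b; rewrite inE -s0 -(near Hs b) // sgr_eq0 unitmxE unitfE.
by rewrite -horner_evalE rmorph_det_basis_mx /= horner_evalE hornerX.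
Unshelve. all: by end_near. Qed.

End Real.
End Cramer.

Theorem proposition1 (R : realType) (m : nat) (E : {set 'I_m.+2 * 'I_m.+2})
    (E_loopless : loopless E) :
  (exists2 alpha : R, 0 <= alpha < 1 & invertible_above E alpha) /\
  (forall alpha : R, 0 <= alpha < 1 -> invertible_above E alpha ->
     exists alpha' : R,
       [/\ 0 < alpha' < 1,
           alpha <= alpha' &
           forall b : R, alpha' <= b < 1 -> Gamma E b = Gamma E alpha']).
Proof.
split=> [|alpha /andP[alpha0 alpha1] _].
  have [a /andP[a0 a1] aP] :=
    near_left_itv ltr01 (@generic_bases_near_unitmx m E R).
  exists a => [|b /andP[ab b1]]; first by rewrite ltW.
  by apply: aP; rewrite ltW.
have [Q HQ] := settled_uniform (@settled_feasible_basis m E R).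
have [a /andP[alphaa a1] aP] := near_left_itv alpha1 HQ.
have GammaE b : a <= b < 1 -> Gamma E b = [set t | Q t]%classic.
  by move=> /aP H; apply/seteqP; split=> t /H.
exists a; split=> [||b /GammaE->]; last by rewrite GammaE ?lexx.
- by rewrite (le_lt_trans alpha0).
- exact: ltW.
Qed.
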